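(* For each integer $m\ge 1$ let $$b_m=\min_{t\in\{1,\dots,m\}}\ \inf_{p\in(0,1)} \frac{m/t-p}{m/t-p^{m/t}}.$$ Then for each fixed $m$ and every $\eta>0$ there is an instance $I$ of the Unreliable Job scheduling Problem with exactly $m$ machines such that $\lambda(I)\le b_m+\eta$, where $\lambda(I)$ is the ratio of the expected reward of the primary Largest-Z-ratio-First schedule of $I$ to the optimal expected reward of $I$.
   Context: Unreliable Job scheduling Problem (UJP). An instance $I$ consists of a number $m\ge 1$ of identical parallel machines $M_1,\dots,M_m$, a finite nonempty set of jobs, where each job $j$ has a success probability $\pi_j$, a rational number with $0<\pi_j<1$, and a reward $r_j\ge 0$ (not all rewards zero), together with a chosen LZF order of the jobs (defined below). A schedule $S$ assigns each job to exactly one machine and orders the jobs on each machine; a machine may be empty. For a schedule and a job $j$, the cumulative probability $P_j$ of job $j$ is the product of the success probabilities of all jobs on the same machine as $j$ up to and including $j$. The expected reward of $S$ is $ER[S]=\sum_j r_j P_j$. $S_{OPT}(I)$ denotes a schedule of maximum expected reward. The Z-ratio of job $j$ is $Z_j=\dfrac{\pi_j r_j}{1-\pi_j}$. An LZF order is an ordering of all the jobs by non-increasing $Z_j$ (ties ordered arbitrarily; the chosen order is part of the instance). The Largest-Z-ratio-First (LZF) algorithm takes the jobs in this order and appends each one to the end of the current sequence of a machine currently having maximum cumulative probability, where the (current) cumulative probability of a machine is the product of the success probabilities of the jobs already scheduled on it (equal to $1$ for an empty machine); ties between machines are broken arbitrarily, which only affects the result up to relabelling machines. The resulting schedule is the primary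 LZF schedule $S_{LZF}(I)$. Finally, $\lambda(I)=\dfrac{ER[S_{LZF}(I)]}{ER[S_{OPT}(I)]}$. *)

(* Defs.v *)
From HB Require Import structures.
From mathcomp Require Import all_boot all_order all_algebra.
From mathcomp Require Import boolp classical_sets reals exp.

Set Implicit Arguments.
Unset Strict Implicit.
Unset Printing Implicit Defensive.

Import Order.TTheory GRing.Theory Num.Theory.
Local Open Scope ring_scope.

Definition Zratio (R : realType) (p : rat) (r : R) : R :=
  ratr p * r / (1 - ratr p).

(* The job set is nonempty as a consequence of [reward_neq0]. *)
Record instance (R : realType) : Type := Instance {
  nmach : nat;
  job : finType;
  prob : job -> rat;
  reward : job -> R;
  lzf_order : seq job;
  nmach_gt0 : (0 < nmach)%N;
  prob_itv : forall j, 0 < prob j < 1;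
  reward_ge0 : forall j, 0 <= reward j;
  reward_neq0 : exists j, reward j != 0;
  lzf_order_perm : perm_eq lzf_order (enum job);
  lzf_order_sorted :
    sorted (fun j k => Zratio (prob k) (reward k) <= Zratio (prob j) (reward j))
      lzf_order
}.

Section Schedules.
Variables (R : realType) (I : instance R).

(* A possibly partial schedule: the sequence of jobs run by each machine. *)
Definition assignment := {ffun 'I_(nmach I) -> seq (job I)}.

Implicit Types (S T : assignment) (i : 'I_(nmach I)) (j : job I).

Definition is_schedule S : bool :=
  [forall j, (\sum_i count_mem j (S i))%N == 1%N].

Definition seq_prob (s : seq (job I)) : R := \prod_(k <- s) ratr (prob k).

(* In a schedule the sum has exactly one term; in a partial schedule it is 0
   when [j] has not been scheduled. *)
Definition cum_prob S j : R :=
  \sum_(i | j \in S i) seq_prob (take (index j (S i)).+1 (S i)).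

Definition ER S : R := \sum_j reward j * cum_prob S j.

Definition optimal S : Prop :=
  is_schedule S /\ forall T, is_schedule T -> ER T <= ER S.

Definition append S i j : assignment :=
  [ffun k => if k == i then rcons (S k) j else S k].

(* [LZF_run S s T]: appending the jobs of [s] one after the other to [S], each
   to some machine of maximum current cumulative probability, can produce [T]. *)
Fixpoint LZF_run S (s : seq (job I)) T : Prop :=
  if s is j :: s' then
    exists i, (forall k, seq_prob (S k) <= seq_prob (S i)) /\
              LZF_run (append S i j) s' T
  else S = T.

Definition is_LZF S : Prop := LZF_run [ffun=> [::]] (lzf_order I) S.

Lemma LZF_run_exists S s : exists T, LZF_run S s T.
Proof.
elim: s S => [|j s IH] S /=; first by exists S.
pose i0 := Ordinal (nmach_gt0 I).
case: (@arg_maxP _ R 'I_(nmach I) i0 predT (fun k => seq_prob (S k)) isT).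
move=> i _ Hi.
by have [T HT] := IH (append S i j); exists T, i; split=> // k; apply: Hi.
Qed.

Lemma LZF_exists : exists S, is_LZF S.
Proof. exact: LZF_run_exists. Qed.

Lemma count_append S i j j' :
  (\sum_k count_mem j' (append S i j k) =
   \sum_k count_mem j' (S k) + (j == j'))%N.
Proof.
rewrite (bigD1 i) //= [in RHS](bigD1 i) //= ffunE eqxx -cats1 count_cat /= addn0.
rewrite addnAC; congr (_ + _ + _)%N.
by apply: eq_bigr => k /negbTE ki; rewrite ffunE ki.
Qed.

Lemma LZF_is_schedule S : is_LZF S -> is_schedule S.
Proof.
move=> HS; apply/forallP => j.
suff H s T U : LZF_run T s U ->
    (\sum_k count_mem j (U k) = \sum_k count_mem j (T k) + count_mem j s)%N.
  rewrite (H _ _ _ HS) big1 => [|k _]; last by rewrite ffunE.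
  rewrite (permP (lzf_order_perm I)) count_uniq_mem ?enum_uniq //.
  by rewrite mem_enum.
elim: s T => [|k s IH] T /= => [->|[i [_ /IH ->]]]; first by rewrite addn0.
by rewrite count_append addnA.
Qed.

Lemma optimal_exists : exists S, optimal S.
Proof.
have [S0 /LZF_is_schedule S0P] := LZF_exists.
pose n := #|job I|.
pose F := {ffun 'I_(nmach I) -> n.-bseq (job I)}.
pose toA (f : F) : assignment := [ffun i => f i : seq _].
have toAP S : is_schedule S -> exists f, toA f = S.
  move=> /forallP SP.
  have sz i : (size (S i) <= n)%N.
    rewrite /n cardE; apply: uniq_leq_size => [|j _]; last by rewrite mem_enum.
    apply/count_mem_uniq => j; have /eqP := SP j.
    rewrite (bigD1 i) //= -has_pred1 has_count.
    by case: (count_mem j (S i)) => [|[|c]].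
  by exists [ffun i => Bseq (sz i)]; apply/ffunP => i; rewrite !ffunE.
have [f0 f0E] := toAP _ S0P; rewrite -f0E in S0P.
case: (@arg_maxP _ R F f0 (fun f => is_schedule (toA f)) (ER \o toA) S0P).
move=> f fP fmax; exists (toA f); split=> // T TP.
by have [g gE] := toAP _ TP; rewrite -gE in TP *; apply: fmax.
Qed.

Definition S_LZF : assignment := projT1 (cid LZF_exists).
Definition S_OPT : assignment := projT1 (cid optimal_exists).

Definition lambda : R := ER S_LZF / ER S_OPT.

Lemma S_LZFP : is_LZF S_LZF.
Proof. exact: projT2 (cid LZF_exists). Qed.

Lemma S_OPTP : optimal S_OPT.
Proof. exact: projT2 (cid optimal_exists). Qed.

Lemma ER_append S i j : (forall k, j \notin S k) ->
  ER (append S i j) = ER S + reward j * (seq_prob (S i) * ratr (prob j)).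
Proof.
move=> jS; rewrite /ER (bigD1 j) //= [in RHS](bigD1 j) //=.
have -> : cum_prob S j = 0 by rewrite /cum_prob big1 // => k; rewrite (negbTE (jS k)).
rewrite mulr0 add0r addrC; congr (_ + _).
  apply: eq_bigr => j' j'j; congr (_ * _); apply: eq_big => k; rewrite ffunE.
    by case: ifP => // _; rewrite mem_rcons inE (negbTE j'j).
  case: ifP => // _; rewrite mem_rcons inE (negbTE j'j) /= => j'k.
  by rewrite -cats1 index_cat j'k takel_cat // index_mem.
congr (_ * _); rewrite /cum_prob (bigD1 i) /=; last first.
  by rewrite ffunE eqxx mem_rcons mem_head.
rewrite big1 => [|k /andP[]]; last first.
  by rewrite ffunE => + /negbTE ki; rewrite ki (negbTE (jS k)).
rewrite addr0 ffunE eqxx -cats1 index_cat (negbTE (jS i)) /= eqxx addn0.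
by rewrite take_oversize ?size_cat ?addn1 // /seq_prob big_cat big_seq1.
Qed.

(* The tie-breaking between machines is immaterial for [lambda]. *)
Lemma ER_LZF_unique S T : is_LZF S -> is_LZF T -> ER S = ER T.
Proof.
pose probs S := [seq seq_prob (S i) | i <- enum 'I_(nmach I)].
suff H s U V : LZF_run U s S -> LZF_run V s T -> uniq s ->
    (forall j k, j \in s -> j \notin U k) ->
    (forall j k, j \in s -> j \notin V k) ->
    perm_eq (probs U) (probs V) -> ER U = ER V -> ER S = ER T.
  move=> HS HT; apply: (H _ _ _ HS HT) => // [|j k _|j k _]; rewrite ?ffunE //.
  by rewrite (perm_uniq (lzf_order_perm I)) enum_uniq.
elim: s U V => [|j s IH] U V /= => [-> -> //|].
move=> [i [imax US]] [k [kmax VT]] /andP[js us] jU jV pUV eUV.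
have eik : seq_prob (U i) = seq_prob (V k).
  apply/le_anti/andP; split.
    have : seq_prob (U i) \in probs V.
      by rewrite -(perm_mem pUV); apply/mapP; exists i; rewrite ?mem_enum.
    by case/mapP => l _ ->.
  have : seq_prob (V k) \in probs U
    by rewrite (perm_mem pUV); apply/mapP; exists k; rewrite ?mem_enum.
  by case/mapP => l _ ->.
have fresh (W : assignment) l : (forall j' k', j' \in j :: s -> j' \notin W k') ->
    forall j' k', j' \in s -> j' \notin append W l j k'.
  move=> jW j' k' j's; rewrite ffunE.
  have jW' : j' \notin W k' by rewrite jW // inE j's orbT.
  case: ifP => // _; rewrite mem_rcons inE negb_or jW' andbT.
  by apply: contraNneq js => <-.
have probsE (W : assignment) l : perm_eq (seq_prob (W l) :: probs (append W l j))
                          (seq_prob (W l) * ratr (prob j) :: probs W).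
  have pl := perm_to_rem (mem_enum 'I_(nmach I) l).
  have pm (X : assignment) : perm_eq (probs X)
      (seq_prob (X l) :: [seq seq_prob (X i0) | i0 <- rem l (enum 'I_(nmach I))]).
    exact: (perm_map (fun i0 => seq_prob (X i0)) pl).
  apply: (@perm_trans _ [:: seq_prob (W l), seq_prob (W l) * ratr (prob j) &
      [seq seq_prob (W i0) | i0 <- rem l (enum 'I_(nmach I))]]).
    rewrite perm_cons; apply: perm_trans (pm _) _.
    rewrite ffunE eqxx -cats1 /seq_prob big_cat big_seq1 perm_cons.
    suff /eq_in_map -> : {in rem l (enum 'I_(nmach I)),
        (fun k' => seq_prob (append W l j k')) =1 (fun k' => seq_prob (W k'))} by [].
    move=> l'; rewrite mem_rem_uniq ?enum_uniq // inE => /andP[/negbTE l'l _].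
    by rewrite ffunE l'l.
  rewrite -cat1s -[_ :: map _ _]cat1s perm_catCA perm_cons perm_sym; exact: pm.
apply: (IH _ _ US VT us) => //.
- exact: fresh.
- exact: fresh.
- rewrite -(perm_cons (seq_prob (U i))) (perm_trans (probsE _ _)) //.
  rewrite perm_sym {1}eik (perm_trans (probsE _ _)) //.
  by rewrite -eik perm_cons perm_sym.
- by rewrite !ER_append ?eUV ?eik // => l; rewrite ?jU ?jV ?mem_head.
Qed.

End Schedules.

(* The seed of the minimum is its [t = 1] term, so it is neutral for [0 < m]. *)
Definition b (R : realType) (m : nat) : R :=
  let h (t : nat) : R :=
    let x : R := m%:R / t%:R in
    inf [set (x - p) / (x - p `^ x) | p in [set p : R | 0 < p < 1]]%classic in
  \big[Num.min/h 1%N]_(1 <= t < m.+1) h t.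

(* Main.v *)
Require Import Defs.
From mathcomp Require Import all_boot all_order all_algebra.
From mathcomp Require Import classical_sets reals exp.
From mathcomp Require Import polyrcf.
From mathcomp Require Import ring lra.

(** When every job has Z-ratio 1, that is [r_j * pi_j = 1 - pi_j], the expected
    reward of a job is the drop [P_(j-1) - P_j] of the cumulative probability
    on its machine. The rewards of a machine telescope, so a schedule earns the
    number of machines minus the sum of their final cumulative probabilities
    ([ER_unit_Zratio]). Moreover every order of the jobs is then an LZF order.

    Fix [m = t + s] machines. The trap consists of [m * t] light jobs of
    success probability [q], listed first, and [s] heavy jobs of tiny success
    probability [e], listed last. The algorithm spreads the light jobs evenly,
    [t] on each machine ([LZF_run_balanced]), and then the heavy jobs can bring
    at most [s] of the final probabilities [q ^ t] down to zero: it earns at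
    most [m - t * q ^ t] ([ER_LZF_bad]). It is better to give each heavy job a
    machine of its own and to put [m] light jobs on each of the [t] other
    machines, which earns [m - t * q ^ m - s * e] ([ER_OPT_bad]).

    As [e] tends to 0, and with [p = q ^ t], the quotient of the two bounds
    tends to [(m / t - p) / (m / t - p ^ (m / t))]. Since [b R m] is the least
    over [t] of the infima over [p] of these numbers, some [t] and [p] come
    within [eta] of it ([b_adherent]). The number [q] must be rational: the
    inequality to be satisfied is strict and polynomial in [q], so it survives
    replacing the real [t]-th root of [p] by a nearby rational
    ([poly_gt0_rat]). *)

Import Order.TTheory GRing.Theory Num.Theory.
Local Open Scope ring_scope.

Set Implicit Arguments.
Unset Strict Implicit.
Unset Printing Implicit Defensive.

(** * Expected reward when all Z-ratios are 1 *)

Lemma ratr_lt1 (R : realType) (p : rat) : (ratr p < 1 :> R) = (p < 1).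
Proof. by rewrite -(rmorph1 (@ratr R)) ltr_rat. Qed.

Section Schedules.
Variables (R : realType) (I : instance R).
Implicit Types (S T U : assignment I) (s : seq (job I)).

Lemma prob_gt0 (j : job I) : 0 < ratr (prob j) :> R.
Proof. by rewrite ltr0q; case/andP: (prob_itv j). Qed.

Lemma prob_lt1 (j : job I) : ratr (prob j) < 1 :> R.
Proof. by rewrite ratr_lt1; case/andP: (prob_itv j). Qed.

Lemma seq_prob_rcons s j : seq_prob (rcons s j) = seq_prob s * ratr (prob j).
Proof. by rewrite /seq_prob -cats1 big_cat big_seq1. Qed.

Lemma seq_prob_ge0 s : 0 <= seq_prob s.
Proof. by apply: prodr_ge0 => j _; rewrite ltW ?prob_gt0. Qed.

Lemma seq_prob_const (p : rat) s :
  {in s, forall j, prob j = p} -> seq_prob s = ratr p ^+ size s.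
Proof.
move=> sp; rewrite /seq_prob big_seq (eq_bigr (fun=> ratr p)).
  by rewrite -big_seq big_const_seq count_predT iter_mulr mulr1.
by move=> j /sp ->.
Qed.

Lemma schedule_uniq S i : is_schedule S -> uniq (S i).
Proof.
move=> /forallP SP; apply/count_mem_uniq => j; have /eqP := SP j.
rewrite (bigD1 i) //= -has_pred1 has_count.
by case: (count_mem j (S i)) => [|[|c]].
Qed.

(** [Zratio] equal to 1, with the denominator cleared. *)
Definition unit_Zratio :=
  forall j : job I, reward j * ratr (prob j) = 1 - ratr (prob j).

(** Each job earns exactly the decrease of the cumulative probability that it
    causes, so the sum telescopes from the value 1 of the empty prefix. *)
Lemma seq_reward_unit s : unit_Zratio -> uniq s ->
  \sum_(j <- s) reward j * seq_prob (take (index j s).+1 s) = 1 - seq_prob s.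
Proof.
move=> Z1; elim/last_ind: s => [|s k IH].
  by rewrite /seq_prob !big_nil subrr.
rewrite rcons_uniq => /andP[ks us].
rewrite -{1}cats1 big_cat big_seq1 /=.
have -> : take (index k (rcons s k)).+1 (rcons s k) = rcons s k.
  by rewrite -cats1 index_cat (negbTE ks) /= eqxx addn0 take_oversize //
    size_cat addn1.
rewrite seq_prob_rcons mulrCA Z1 mulrBr mulr1 big_seq.
rewrite (eq_bigr (fun j => reward j * seq_prob (take (index j s).+1 s))).
  by rewrite -big_seq IH // addrA subrK.
by move=> j js; rewrite -cats1 index_cat js takel_cat ?index_mem.
Qed.

(** Only the final cumulative probabilities matter: maximizing the expected
    reward amounts to minimizing their sum. *)
Lemma ER_unit_Zratio S : unit_Zratio -> is_schedule S ->
  ER S = (nmach I)%:R - \sum_i seq_prob (S i).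
Proof.
move=> Z1 SP; rewrite /ER /cum_prob.
under eq_bigr do rewrite big_distrr.
rewrite (exchange_big_dep predT) //=.
rewrite -[X in _ = X%:R - _]card_ord -sumr_const -sumrB.
apply: eq_bigr => i _; have us := schedule_uniq i SP.
by rewrite -(big_uniq _ us) seq_reward_unit.
Qed.

(** * Runs of the algorithm *)

Lemma LZF_run_cat S s1 s2 T : LZF_run S (s1 ++ s2) T ->
  exists2 U, LZF_run S s1 U & LZF_run U s2 T.
Proof.
elim: s1 S => [|j s1 IH] S /=; first by exists S.
by case=> i [imax /IH[U SU UT]]; exists U => //; exists i.
Qed.

Definition balanced S := forall i k, (size (S i) <= (size (S k)).+1)%N.

(** A load different from the average [n] would force all the others, by
    balance, to lie on the same side of [n], contradicting the total. *)
Lemma balanced_size S n : balanced S ->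
  (\sum_i size (S i) = nmach I * n)%N -> forall i, size (S i) = n.
Proof.
move=> bS; rewrite -[X in _ = (X * _)%N]card_ord -sum_nat_const => sumS i.
apply/eqP; rewrite eqn_leq; apply/andP; split; rewrite leqNgt; apply/negP => h.
  have : (\sum_(k < nmach I) n < \sum_k size (S k))%N.
    rewrite (bigD1 i) //= [ltnRHS](bigD1 i) //= -addSn leq_add // leq_sum //.
    by move=> k _; rewrite -ltnS (leq_trans h).
  by rewrite sumS ltnn.
have : (\sum_k size (S k) < \sum_(k < nmach I) n)%N.
  rewrite (bigD1 i) //= [ltnRHS](bigD1 i) //= -addSn leq_add // leq_sum //.
  by move=> k _; rewrite (leq_trans (bS k i)).
by rewrite sumS ltnn.
Qed.

Lemma sum_size_append S i j :
  (\sum_k size (append S i j k) = (\sum_k size (S k)).+1)%N.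
Proof.
rewrite (bigD1 i) //= [in RHS](bigD1 i) //= ffunE eqxx size_rcons.
by congr (_ + _).+1; apply: eq_bigr => k /negbTE ki; rewrite ffunE ki.
Qed.

(** On identical jobs of probability [p < 1], a machine of maximum cumulative
    probability [p ^ load] is one of minimum load, so the algorithm keeps the
    loads within one of each other. *)
Lemma LZF_run_balanced (p : rat) S s T : 0 < p < 1 -> LZF_run S s T ->
  {in s, forall j, prob j = p} -> (forall i, {in S i, forall j, prob j = p}) ->
  balanced S ->
  [/\ forall i, {in T i, forall j, prob j = p}, balanced T &
      (\sum_i size (T i) = \sum_i size (S i) + size s)%N].
Proof.
case/andP=> p0 p1; elim: s S => [|j s IH] S /=.
  by move=> <- _ Sp bS; rewrite addn0.
case=> i [imax run] sp Sp bS.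
have imin k : (size (S i) <= size (S k))%N.
  have := imax k; rewrite !(seq_prob_const (Sp _)).
  by rewrite ler_iXn2l // ?ltr0q ?ratr_lt1.
have [|||Tp bT ->] := IH _ run.
- by move=> k ks; apply: sp; rewrite inE ks orbT.
- move=> k l; rewrite ffunE; case: ifP => _; last exact: Sp.
  by rewrite mem_rcons inE => /predU1P[->|/Sp //]; apply: sp; rewrite mem_head.
- move=> k l; rewrite !ffunE; case: (eqVneq k i) => [->|_];
    case: (eqVneq l i) => [->|_]; rewrite ?size_rcons ?ltnS //.
  exact: leqW.
by split=> //; rewrite sum_size_append addSnnS.
Qed.

(** Appending a job changes a single term of the sum, and a term in [[0, c]]
    cannot lose more than [c]. This crude bound makes it unnecessary to know
    which machines receive the last jobs. *)
Lemma LZF_run_sum_ge (c : R) S s T : LZF_run S s T ->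
  (forall i, seq_prob (S i) <= c) ->
  \sum_i seq_prob (S i) - c *+ size s <= \sum_i seq_prob (T i).
Proof.
elim: s S => [|j s IH] S /=; first by move=> ->; rewrite subr0.
case=> i [_ run] Sc; set S' := append S i j in run.
have S'i : seq_prob (S' i) = seq_prob (S i) * ratr (prob j).
  by rewrite ffunE eqxx seq_prob_rcons.
have S'k k : k != i -> seq_prob (S' k) = seq_prob (S k).
  by rewrite ffunE => /negbTE ->.
have S'c k : seq_prob (S' k) <= c.
  have [->|/S'k -> //] := eqVneq k i.
  by rewrite S'i (le_trans _ (Sc i)) // ler_piMr ?seq_prob_ge0 // ltW ?prob_lt1.
apply: le_trans (IH _ run S'c); rewrite mulrS opprD addrA lerD2r.
rewrite (bigD1 i) //= [leRHS](bigD1 i) //= (eq_bigr _ S'k) addrAC lerD2r.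
by rewrite (le_trans _ (seq_prob_ge0 _)) // subr_le0.
Qed.

(** * Schedules given by a choice of machines *)

Definition schedule_of (h : job I -> 'I_(nmach I)) : assignment I :=
  [ffun i => [seq j <- enum (job I) | h j == i]].

Lemma schedule_ofP h : is_schedule (schedule_of h).
Proof.
have u i : uniq (schedule_of h i) by rewrite ffunE filter_uniq ?enum_uniq.
have hS i j : (j \in schedule_of h i) = (h j == i).
  by rewrite ffunE mem_filter mem_enum andbT.
apply/forallP => j; rewrite (bigD1 (h j)) //= big1 ?addn0 => [|i ij].
  by rewrite count_uniq_mem // hS eqxx.
by rewrite count_uniq_mem // hS eq_sym (negbTE ij).
Qed.

Lemma seq_prob_schedule_of h i :
  seq_prob (schedule_of h i) = \prod_(j | h j == i) ratr (prob j).
Proof. by rewrite /seq_prob ffunE big_filter big_enum_cond. Qed.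

End Schedules.

(** * The trap for the greedy algorithm *)

Section BadInstance.
Variables (R : realType) (t s : nat) (q e : rat).
Hypotheses (t_gt0 : (0 < t)%N) (q01 : 0 < q < 1) (e01 : 0 < e < 1).

(** Light jobs are indexed by pairs so that both ways of spreading them, [t] on
    each of the [t + s] machines or [t + s] on each of [t] machines, are
    immediate to count. *)
Definition bad_job : finType := ('I_(t + s) * 'I_t + 'I_s)%type.

Definition bad_prob (j : bad_job) : rat := if j is inl _ then q else e.

(** The reward that makes the Z-ratio equal to 1. *)
Definition bad_reward (j : bad_job) : R :=
  (1 - ratr (bad_prob j)) / ratr (bad_prob j).

(** All Z-ratios being equal, any order is admissible; scheduling the light jobs
    first is what misleads the algorithm. *)
Definition bad_order : seq bad_job :=
  map inl (enum {: 'I_(t + s) * 'I_t}) ++ map inr (enum 'I_s).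

Fact bad_prob_itv j : 0 < bad_prob j < 1.
Proof. by case: j. Qed.

Fact bad_prob_gt0 j : 0 < ratr (bad_prob j) :> R.
Proof. by rewrite ltr0q; case/andP: (bad_prob_itv j). Qed.

Fact bad_prob_lt1 j : ratr (bad_prob j) < 1 :> R.
Proof. by rewrite ratr_lt1; case/andP: (bad_prob_itv j). Qed.

Fact bad_reward_gt0 j : 0 < bad_reward j.
Proof. by rewrite divr_gt0 ?bad_prob_gt0 // subr_gt0 bad_prob_lt1. Qed.

Fact bad_reward_neq0 : exists j, bad_reward j != 0.
Proof.
by exists (inl (lshift s (Ordinal t_gt0), Ordinal t_gt0)); rewrite gt_eqF
  ?bad_reward_gt0.
Qed.

Fact bad_order_perm : perm_eq bad_order (enum bad_job).
Proof.
apply: uniq_perm; rewrite ?enum_uniq //.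
  have inl_inj : injective (@inl ('I_(t + s) * 'I_t) 'I_s) by move=> ? ? [].
  have inr_inj : injective (@inr ('I_(t + s) * 'I_t) 'I_s) by move=> ? ? [].
  rewrite cat_uniq (map_inj_uniq inl_inj) (map_inj_uniq inr_inj).
  rewrite !enum_uniq andbT.
  by apply/hasPn => _ /mapP[d _ ->]; apply/mapP => -[].
move=> j; rewrite mem_enum mem_cat; case: j => j.
  by rewrite map_f ?mem_enum.
by rewrite [X in _ || X]map_f ?mem_enum ?orbT.
Qed.

Fact bad_unit_Zratio j :
  bad_reward j * ratr (bad_prob j) = 1 - ratr (bad_prob j).
Proof. by rewrite divfK // gt_eqF ?bad_prob_gt0. Qed.

Fact bad_order_sorted :
  sorted (fun j k => Zratio (bad_prob k) (bad_reward k)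
                     <= Zratio (bad_prob j) (bad_reward j)) bad_order.
Proof.
have Z1 j : Zratio (bad_prob j) (bad_reward j) = 1.
  rewrite /Zratio [ratr _ * _]mulrC bad_unit_Zratio divff // gt_eqF //.
  by rewrite subr_gt0 bad_prob_lt1.
by case: bad_order => //= j l; elim: l j => //= k l IH j; rewrite !Z1 lexx IH.
Qed.

Definition bad_instance : instance R :=
  Instance (ltn_addr s t_gt0) bad_prob_itv (fun j => ltW (bad_reward_gt0 j))
    bad_reward_neq0 bad_order_perm bad_order_sorted.

Let Q : R := ratr q.

(** After the light jobs all [t + s] machines are at [Q ^ t]; the [s] heavy jobs
    lower the sum of these by at most [s * Q ^ t], which leaves [t * Q ^ t]. *)
Lemma ER_LZF_bad :
  ER (S_LZF bad_instance) <= (t + s)%:R - t%:R * Q ^+ t.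
Proof.
have run := S_LZFP bad_instance.
rewrite ER_unit_Zratio; [|exact: bad_unit_Zratio|exact: LZF_is_schedule].
rewrite lerD2l lerN2.
have [U run1 run2] := LZF_run_cat run.
have [|||Up Ub Usum] := @LZF_run_balanced _ bad_instance q _ _ _ q01 run1.
- by move=> _ /mapP[j _ ->].
- by move=> i j; rewrite ffunE.
- by move=> i k; rewrite !ffunE.
have Usz : forall i, size (U i) = t.
  apply: balanced_size => //; rewrite Usum big1 => [|i _]; last first.
    by rewrite ffunE.
  by rewrite size_map -cardE card_prod !card_ord.
have UQ i : seq_prob (U i) = Q ^+ t by rewrite (seq_prob_const (Up i)) Usz.
apply: le_trans (LZF_run_sum_ge run2 (c := Q ^+ t) _); last first.
  by move=> i; rewrite UQ.
rewrite (eq_bigr _ (fun i _ => UQ i)) sumr_const card_ord size_map.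
by rewrite -cardE card_ord -mulrnBr ?leq_addl // addnK mulr_natl.
Qed.

(** The competing schedule: the heavy jobs are alone on the last [s] machines,
    and the light jobs are divided equally between the first [t]. *)
Definition good_home (j : bad_job) : 'I_(t + s) :=
  match j with inl (_, c) => lshift s c | inr d => rshift t d end.

Lemma ER_OPT_bad :
  (t + s)%:R - t%:R * Q ^+ (t + s) - s%:R * ratr e <= ER (S_OPT bad_instance).
Proof.
have [_ opt] := S_OPTP bad_instance.
pose T := @schedule_of _ bad_instance good_home.
have TP : is_schedule T := schedule_ofP _.
apply: le_trans (opt _ TP).
rewrite ER_unit_Zratio //; last exact: bad_unit_Zratio.
rewrite -addrA -opprD lerD2l lerN2 big_split_ord /=.
under eq_bigr do rewrite seq_prob_schedule_of.
under [X in _ + X]eq_bigr do rewrite seq_prob_schedule_of.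
apply: lerD.
  (* a machine of light jobs only: one job for each first index *)
  rewrite mulr_natl -[X in _ *+ X]card_ord -sumr_const; apply: ler_sum => c _.
  rewrite big_sumType /= [X in _ * X]big1; last first.
    by move=> d; rewrite eq_rlshift.
  rewrite mulr1 (eq_bigl (fun j => true && (j.2 == c))); last first.
    by case=> k d; rewrite /= eq_lshift.
  rewrite -(pair_big xpredT (pred1 c) (fun _ _ => Q)) /=.
  under eq_bigr do rewrite big_pred1_eq.
  by rewrite prodr_const card_ord.
(* a machine with a single heavy job *)
rewrite mulr_natl -[X in _ *+ X]card_ord -sumr_const; apply: ler_sum => d _.
rewrite big_sumType /= [X in X * _]big1; last first.
  by case=> k c; rewrite eq_lrshift.
rewrite mul1r (eq_bigl (pred1 d)) ?big_pred1_eq // => d' /=.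
by rewrite eq_rshift.
Qed.

Lemma lambda_bad (c : R) :
  (t + s)%:R - t%:R * Q ^+ t
    <= c * ((t + s)%:R - t%:R * Q ^+ (t + s) - s%:R * ratr e) ->
  0 <= c -> 0 < (t + s)%:R - t%:R * Q ^+ (t + s) - s%:R * ratr e ->
  lambda bad_instance <= c.
Proof.
move=> le_c c0 pos; rewrite /lambda ler_pdivrMr.
  apply: le_trans ER_LZF_bad _; apply: le_trans le_c _.
  exact: ler_wpM2l ER_OPT_bad.
exact: lt_le_trans pos ER_OPT_bad.
Qed.

End BadInstance.

(** * Approaching the bound *)

(** The minimum over [t] is attained, and the infimum over [p] is approached
    because the quotients are bounded below by 0: here [m / t >= 1 > p], and
    [p ^ (m / t) <= p]. *)
Lemma b_adherent (R : realType) (m : nat) (eta : R) : (0 < m)%N -> 0 < eta ->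
  exists t (p : R), [/\ (0 < t <= m)%N, 0 < p < 1 &
    (m%:R / t%:R - p) / (m%:R / t%:R - p `^ (m%:R / t%:R)) < b R m + eta].
Proof.
move=> m_gt0 eta_gt0.
pose h (t : nat) : R :=
  inf [set (m%:R / t%:R - p) / (m%:R / t%:R - p `^ (m%:R / t%:R))
    | p in [set p : R | 0 < p < 1]]%classic.
have -> : b R m = \big[Num.min/h 1%N]_(1 <= t < m.+1) h t by [].
have [t /andP[t_gt0 t_le] ->] : exists2 t, (0 < t <= m)%N &
    \big[Num.min/h 1%N]_(1 <= t < m.+1) h t = h t.
  rewrite big_nat.
  apply: (big_ind (fun x => exists2 t, (0 < t <= m)%N & x = h t))
    => [|x y [t tP ->] [u uP ->]|t tP].
  - by exists 1%N; rewrite ?m_gt0.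
  - by rewrite minEle; case: ifP => _; [exists t|exists u].
  - by exists t.
have x_ge1 : 1 <= m%:R / t%:R :> R.
  by rewrite ler_pdivlMr ?ltr0n // mul1r ler_nat.
have hinf : has_inf
    [set (m%:R / t%:R - p) / (m%:R / t%:R - p `^ (m%:R / t%:R))
      | p in [set p : R | 0 < p < 1]]%classic.
  split; first by eexists; exists 2^-1 => //=; lra.
  exists 0 => _ [p /= /andP[p0 p1] <-].
  have px : p `^ (m%:R / t%:R) <= p by rewrite ge1r_powR // p0 ltW.
  by apply: divr_ge0; lra.
have [_ [p p01 <-] lt_h] := inf_adherent eta_gt0 hinf.
by exists t, p; rewrite t_gt0 t_le.
Qed.

(** Polynomials are continuous and the rationals are dense. *)
Lemma poly_gt0_rat (R : realType) (g : {poly R}) (a : R) :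
  0 < a < 1 -> 0 < g.[a] -> exists q : rat, 0 < q < 1 /\ 0 < g.[ratr q].
Proof.
move=> /andP[a0 a1] ga0; have [d d0 gd] := poly_cont a g ga0.
have [|q] := @rat_in_itvoo _ a (Num.min 1 (a + d)).
  by rewrite lt_min a1 ltrDl.
rewrite in_itv /= lt_min => /and3P[aq q1 qd].
exists q; rewrite -(ratr_lt1 R) -(ltr0q R) q1 (lt_trans a0 aq); split=> //.
have := gd (ratr q); rewrite gtr0_norm ?subr_gt0 // ltrBlDl => /(_ qd).
by rewrite ltr_norml => /andP[]; lra.
Qed.

Theorem proposition3p1 (R : realType) (m : nat) (hm : (1 <= m)%N)
    (eta : R) (heta : 0 < eta) :
  exists I : instance R, nmach I = m /\ lambda I <= b R m + eta.
Proof.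
have [t [p [/andP[t0 tm] /andP[p0 p1]]]] := b_adherent hm heta.
move: (b R m + eta) => c; have {hm tm} [s ->] : exists s, m = (t + s)%N.
  by exists (m - t)%N; rewrite subnKC.
set x : R := (t + s)%:R / t%:R => lt_c.
have tR0 : 0 < t%:R :> R by rewrite ltr0n.
have xE : (t + s)%:R = t%:R * x by rewrite mulrC divfK ?gt_eqF.
have gt0 k (y : R) : (0 < k)%N -> 0 < y < 1 -> 0 < (t + s)%:R - t%:R * y ^+ k.
  move=> k0 /andP[y0 y1]; rewrite subr_gt0.
  apply: (@lt_le_trans _ _ t%:R); last by rewrite ler_nat leq_addr.
  by rewrite gtr_pMr // exprn_ilt1 ?ltW // -lt0n.
pose a := p `^ t%:R^-1.
have a0 : 0 < a by rewrite powR_gt0.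
have at_p : a ^+ t = p.
  by rewrite -powR_mulrn ?ltW // -powRrM mulVf ?gt_eqF // powRr1 ?ltW.
have am_p : a ^+ (t + s) = p `^ x.
  by rewrite -powR_mulrn ?ltW // -powRrM mulrC.
have a1 : a < 1.
  by rewrite ltNge; apply/negP => /(exprn_ege1 t); rewrite at_p leNgt p1.
(* [g.[y] > 0] says, with the denominator cleared, that the quotient of the two
   bounds at [q = y] and [e = 0] is less than [c]. *)
pose g : {poly R} :=
  ((c - 1) * (t + s)%:R)%:P - (c * t%:R) *: 'X^(t + s) + t%:R *: 'X^t.
have gE y : g.[y] = c * ((t + s)%:R - t%:R * y ^+ (t + s))
                    - ((t + s)%:R - t%:R * y ^+ t).
  by rewrite /g !hornerE; ring.
have ga : 0 < g.[a].
  have := gt0 (t + s)%N a (ltn_addr s t0) (introT andP (conj a0 a1)).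
  rewrite gE at_p am_p xE -!mulrBr.
  rewrite pmulr_rgt0 // => d0; move: lt_c; rewrite ltr_pdivrMr // => lt_c.
  by rewrite mulrCA -mulrBr mulr_gt0 // subr_gt0.
have [q [q01]] := poly_gt0_rat (introT andP (conj a0 a1)) ga.
rewrite gE.
have Q01 : 0 < (ratr q : R) < 1 by rewrite ratr_lt1 ltr0q.
have N0 := gt0 t _ t0 Q01; have D0 := gt0 (t + s)%N _ (ltn_addr s t0) Q01.
set N := (X in _ - X); set D := (X in c * X - _) => gq.
have c0 : 0 < c by rewrite -(pmulr_lgt0 _ D0) (lt_trans N0) // -subr_gt0.
have s0 : 0 < c * (s%:R + 1) by rewrite mulr_gt0 // natr1 ltr0n.
(* The slack [c * D - N] pays for [c * s * e]; adding 1 to [s] keeps the divisor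
   positive when there is no heavy job. *)
have [|e] := @rat_in_itvoo R 0 (Num.min 1 ((c * D - N) / (c * (s%:R + 1)))).
  by rewrite lt_min ltr01 divr_gt0.
rewrite in_itv /= lt_min (ltr_pdivlMr _ _ s0) => /and3P[e0 e1 eN].
have e01 : 0 < e < 1 by rewrite -(ratr_lt1 R) -(ltr0q R e) e0.
have le_c : N <= c * (D - s%:R * ratr e).
  move: (ratr e : R) e0 eN => E E0 EN.
  by have := mulr_gt0 c0 E0; lra.
exists (bad_instance R s t0 q01 e01); split=> //.
apply: (lambda_bad t0 q01 e01 le_c (ltW c0)).
by rewrite -(pmulr_rgt0 _ c0) (lt_le_trans N0).
Qed.
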